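(* Let $a$ be the multiplicative function with $a(p^f)=\sigma_1(p^f)$ for odd primes $p$ and $a(2^f)=2^f$, and let $b$ be the multiplicative function with $b(p^f)=\sigma_1(p^f)$ for odd primes $p$ and $b(2^f)=0$ for $f\ge1$. For a positive integer $j$ define the entire function $$c_j(s)=\sum_{d\mid j}a(d)\,b\!\left(\frac{j}{d}\right)\left(\frac{j}{d^2}\right)^{s/2},\qquad s\in\mathbb{C}.$$ Then for every positive integer $j$, all zeros of $c_j(s)$ lie on the imaginary axis $\operatorname{Re}(s)=0$.
   Context: $\sigma_1(n)$ denotes the sum of the positive divisors of $n$. *)

(* Defs.v *)
From HB Require Import structures.
From mathcomp Require Import all_boot all_order all_algebra.
From mathcomp Require Import reals sequences exp trigo.
From mathcomp Require Import complex.

Set Implicit Arguments.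
Unset Strict Implicit.
Unset Printing Implicit Defensive.

Import Order.TTheory GRing.Theory Num.Theory.

Definition sigma1 (n : nat) : nat := \sum_(d <- divisors n) d.

(* Arithmetic functions live on the positive integers; the value at 0 is
   unconstrained. *)
Definition multiplicative_arith (f : nat -> nat) : Prop :=
  f 1 = 1 /\
  forall m n, 0 < m -> 0 < n -> coprime m n -> f (m * n) = f m * f n.

(* A multiplicative function with prescribed values at prime powers exists. *)
Lemma multiplicative_arith_ex (g : nat -> nat -> nat) :
    (forall p, g p 0 = 1) ->
  exists f, multiplicative_arith f /\
    forall p k, prime p -> f (p ^ k) = g p k.
Proof.
move=> g0; exists (fun n => \prod_(p <- primes n) g p (logn p n)).
split; [split|]; first by rewrite big_nil.
- move=> m n m0 n0 co_mn.
  have pE : perm_eq (primes (m * n)) (primes m ++ primes n).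
    apply: uniq_perm; first exact: primes_uniq.
      rewrite cat_uniq !primes_uniq andbT /= -coprime_has_primes //.
    by move=> p; rewrite mem_cat primesM.
  rewrite (perm_big _ pE) big_cat /=; congr (_ * _)%N.
    rewrite big_seq [RHS]big_seq; apply: eq_bigr => p.
    rewrite mem_primes => /and3P[p_pr _ p_m].
    rewrite lognM // (@logn_coprime p n) ?addn0 //.
    exact: coprime_dvdl p_m co_mn.
  rewrite big_seq [RHS]big_seq; apply: eq_bigr => p.
  rewrite mem_primes => /and3P[p_pr _ p_n].
  rewrite lognM // (@logn_coprime p m) ?add0n //.
  by apply: coprime_dvdl p_n _; rewrite coprime_sym.
- move=> p [|k] p_pr; first by rewrite expn0 big_nil g0.
  by rewrite primesX // primes_prime // big_seq1 pfactorK.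
Qed.

Local Open Scope ring_scope.
Local Open Scope complex_scope.

Definition cexp (R : realType) (z : R[i]) : R[i] :=
  (expR (complex.Re z))%:C * (cos (complex.Im z) +i* sin (complex.Im z)).

(* The power of a positive real base; only meaningful for 0 < x, since
   [ln x = 0] for x <= 0. *)
Definition rcpow (R : realType) (x : R) (z : R[i]) : R[i] :=
  cexp (z * (ln x)%:C).

Definition cfun (R : realType) (a b : nat -> nat) (j : nat) (s : R[i]) : R[i] :=
  \sum_(d <- divisors j)
    (a d)%:R * (b (j %/ d)%N)%:R * rcpow (j%:R / d%:R ^+ 2) (s / 2%:R).

(* Main.v *)
Require Import Defs.
From mathcomp Require Import all_boot all_order all_algebra.
From mathcomp Require Import reals sequences exp trigo.
From mathcomp Require Import complex.
From mathcomp Require Import ring.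

(** The function c_j is multiplicative in j, so it suffices to treat j = p^f.
    For p = 2 only the divisor d = 2^f contributes and c_j has no zero.  For p
    odd put z = p^(-s); up to a nonvanishing factor c_j(s) is
      \sum_k sigma1(p^k) sigma1(p^(f-k)) z^k,
    the complete homogeneous symmetric polynomial of degree f in 1, p, z, pz.
    Exchanging the roles of p and z, (z - 1)^2 times it equals
      \sum_k p^k (z^(k+1) - 1) (z^(f-k+1) - 1).
    If |z| > 1, then 1/(u - 1) + 1/2 has positive real part for each power
    u = z^(k+1), hence so has
      (uv - 1) / ((u - 1)(v - 1)) = 1/(u - 1) + 1/(v - 1) + 1,
    where v = z^(f-k+1) and uv = z^(f+2).  Thus all the summands divided by
    z^(f+2) - 1 lie in the right half-plane and the sum cannot vanish; for
    |z| < 1 they all lie in the left half-plane.  So |z| = 1, i.e. Re s = 0. *)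

Set Implicit Arguments.
Unset Strict Implicit.
Unset Printing Implicit Defensive.

Import Order.TTheory GRing.Theory Num.Theory.

Local Open Scope ring_scope.
Local Open Scope complex_scope.

(** * Exchange of the two variables in a geometric convolution *)

(** Expanding leaves only geometric sums, because [q ^+ k.+1 * q ^+ (f - k).+1] does not depend on
    [k]. *)
Lemma geom_conv_split (R : comNzRingType) (q z : R) (f : nat) :
  \sum_(k < f.+1) z ^+ k * ((q ^+ k.+1 - 1) * (q ^+ (f - k).+1 - 1)) =
  (q ^+ f.+2 + 1) * (\sum_(k < f.+1) z ^+ k)
  - q * (\sum_(k < f.+1) (q * z) ^+ k)
  - q * (\sum_(k < f.+1) q ^+ (f - k) * z ^+ k).
Proof.
rewrite !mulr_sumr -!sumrB; apply: eq_bigr => k _.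
have -> : q ^+ f.+2 = q ^+ k * q ^+ (f - k) * q ^+ 2.
  by rewrite -!exprD; congr (_ ^+ _); rewrite subnKC ?addn2 // -ltnS.
by rewrite exprMn !exprS; ring.
Qed.

(* Up to the factor [(q - 1)^2 (z - 1)^2], both sides are the complete
   homogeneous symmetric polynomial of degree f in 1, q, z, q z. *)
Lemma geom_conv_swap (R : comNzRingType) (q z : R) (f : nat) :
  (z - 1) ^+ 2 *
    (\sum_(k < f.+1) z ^+ k * ((q ^+ k.+1 - 1) * (q ^+ (f - k).+1 - 1))) =
  (q - 1) ^+ 2 *
    (\sum_(k < f.+1) q ^+ k * ((z ^+ k.+1 - 1) * (z ^+ (f - k).+1 - 1))).
Proof.
rewrite !geom_conv_split.
have Gz := subrX1 z f.+1; have Gq := subrX1 q f.+1.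
have GK := subrX1 (q * z) f.+1; have GH := subrXX q z f.+1.
have -> : \sum_(k < f.+1) z ^+ (f - k) * q ^+ k =
          \sum_(k < f.+1) q ^+ (f - k) * z ^+ k.
  rewrite (reindex_inj rev_ord_inj) /=; apply: eq_bigr => k _.
  by rewrite subSS subKn 1?mulrC // -ltnS.
rewrite [z * q]mulrC ![_ ^+ f.+2]exprS.
rewrite exprMn /= in GK GH.
move: (q ^+ f.+1) (z ^+ f.+1) Gz Gq GK GH => Q Z.
move: (\sum_(i < f.+1) z ^+ i) (\sum_(i < f.+1) q ^+ i) => G G'.
move: (\sum_(i < f.+1) (q * z) ^+ i) => K.
move: (\sum_(i < f.+1) q ^+ (f - i) * z ^+ i) => H Gz Gq GK GH.
(* The coefficients differ by [(q z - 1) (z - q)], whose factors cancel the denominators of the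
   geometric sums [K] and [H]. *)
have E : q * (z - 1) ^+ 2 * (K + H) = z * (q - 1) ^+ 2 * (K + H)
         + (z - q) * (Q * Z - 1) - (q * z - 1) * (Q - Z).
  by rewrite GK GH; ring.
transitivity ((z - 1) * (q * Q + 1) * ((z - 1) * G)
              - q * (z - 1) ^+ 2 * (K + H)); first by ring.
transitivity ((q - 1) * (z * Z + 1) * ((q - 1) * G')
              - z * (q - 1) ^+ 2 * (K + H)); last by ring.
by rewrite -Gz -Gq E; ring.
Qed.

(** * Squared modulus and the half-plane argument *)

Section Complex.
Variable R : realType.
Implicit Types u v w z : R[i].

Definition normsq z : R := complex.Re z ^+ 2 + complex.Im z ^+ 2.

Lemma normsqM u v : normsq (u * v) = normsq u * normsq v.
Proof. by case: u v => [a b] [c d]; rewrite /normsq /=; ring. Qed.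

Lemma normsq1 : normsq 1 = 1.
Proof. by rewrite /normsq /=; ring. Qed.

Lemma normsqX z n : normsq (z ^+ n) = normsq z ^+ n.
Proof.
by elim: n => [|n IH]; rewrite ?expr0 ?normsq1 // !exprS normsqM IH.
Qed.

Lemma normsq_ge0 z : 0 <= normsq z.
Proof. by rewrite addr_ge0 ?sqr_ge0. Qed.

Lemma normsq_sub1_gt0 z : normsq z != 1 -> 0 < normsq (z - 1).
Proof.
move=> z1; rewrite lt_neqAle normsq_ge0 andbT; apply: contra z1.
case: z => x y; rewrite /normsq /= eq_sym paddr_eq0 ?sqr_ge0 //.
rewrite !sqrf_eq0 subr_eq0 oppr0 addr0 => /andP[/eqP-> /eqP->].
by apply/eqP; ring.
Qed.

Lemma Re_realM (x : R) z : complex.Re (x%:C * z) = x * complex.Re z.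
Proof. by case: z => a b /=; ring. Qed.

Lemma Re_sum (I : Type) (r : seq I) (F : I -> R[i]) :
  complex.Re (\sum_(i <- r) F i) = \sum_(i <- r) complex.Re (F i).
Proof. by apply: (big_morph (@complex.Re R)) => // -[a b] [c d]. Qed.

(* This is [Re (1 / (u - 1) + 1 / 2) = (|u|^2 - 1) / (2 |u - 1|^2)] for u and
   for v, added up and with the denominators cleared. *)
Lemma Re_half_plane u v :
  2 * complex.Re ((u - 1) * (v - 1) * (u * v - 1)^*) =
  normsq (u - 1) * (normsq v - 1) + normsq (v - 1) * (normsq u - 1).
Proof. by case: u v => [a b] [c d]; rewrite /normsq /=; ring. Qed.

Lemma geom_conv_neq0 (q : R) z (f : nat) : 0 < q -> normsq z != 1 ->
  \sum_(k < f.+1) q%:C ^+ k * ((z ^+ k.+1 - 1) * (z ^+ (f - k).+1 - 1)) != 0.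
Proof.
move=> q0 z1; apply/eqP => S0.
(* Twice the real part of the [k]-th summand times that conjugate: [Re_half_plane] with
   [u = z ^+ k.+1] and [v = z ^+ (f - k).+1]. *)
pose t (k : 'I_f.+1) := q ^+ k *
  (normsq (z ^+ k.+1 - 1) * (normsq z ^+ (f - k).+1 - 1)
   + normsq (z ^+ (f - k).+1 - 1) * (normsq z ^+ k.+1 - 1)).
have St0 : \sum_k t k = 0.
  transitivity (2 * complex.Re (0 * (z ^+ f.+2 - 1)^*)); last first.
    by rewrite mul0r mulr0.
  rewrite -S0 mulr_suml Re_sum mulr_sumr; apply: eq_bigr => k _.
  have -> : z ^+ f.+2 = z ^+ k.+1 * z ^+ (f - k).+1.
    by rewrite -exprD addnS addSn subnKC // -ltnS.
  rewrite -mulrA -rmorphXn Re_realM mulrCA Re_half_plane.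
  by rewrite !normsqX.
have nz0 := normsq_ge0 z.
have nX n : normsq (z ^+ n.+1) != 1.
  by rewrite normsqX pexpr_eq1.
have D n := normsq_sub1_gt0 (nX n).
have [lt1|gt1|eq1] := ltgtP (normsq z) 1; last by rewrite eq1 eqxx in z1.
- have tN k : t k < 0.
    rewrite /t pmulr_rlt0 ?exprn_gt0 //.
    by rewrite -oppr_gt0 opprD -!mulrN addr_gt0 // mulr_gt0 ?D //
      oppr_gt0 subr_lt0 exprn_ilt1.
  move: St0; rewrite big_ord_recl => /eqP; rewrite lt_eqF //.
  by rewrite ltr_wnDr // sumr_le0 // => k _; exact: ltW.
- have tP k : 0 < t k.
    rewrite /t mulr_gt0 ?exprn_gt0 //.
    by rewrite addr_gt0 // mulr_gt0 ?D // subr_gt0 exprn_egt1.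
  move: St0; rewrite big_ord_recl => /eqP; rewrite gt_eqF //.
  by rewrite ltr_wpDr // sumr_ge0 // => k _; exact: ltW.
Qed.

(** * Complex powers of positive reals *)

Lemma cexpD u v : cexp (u + v) = cexp u * cexp v.
Proof.
case: u v => [a b] [c d]; rewrite /cexp /= expRD cosD sinD.
by apply/eqP; rewrite eq_complex /=; apply/andP; split; apply/eqP; ring.
Qed.

Lemma cexp0 : cexp 0 = 1 :> R[i].
Proof.
rewrite /cexp /= expR0 cos0 sin0.
by apply/eqP; rewrite eq_complex /=; apply/andP; split; apply/eqP; ring.
Qed.

Lemma normsq_cexp z : normsq (cexp z) = expR (complex.Re z) ^+ 2.
Proof.
rewrite -[RHS]mulr1 -(cos2Dsin2 (complex.Im z)) /cexp /normsq /=.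
by ring.
Qed.

Lemma rcpowM (x y : R) z : 0 < x -> 0 < y ->
  rcpow (x * y) z = rcpow x z * rcpow y z.
Proof.
by move=> x0 y0; rewrite /rcpow lnM // rmorphD mulrDr cexpD.
Qed.

Lemma rcpow1 z : rcpow 1 z = 1.
Proof. by rewrite /rcpow ln1 rmorph0 mulr0 cexp0. Qed.

Lemma rcpow_neq0 (x : R) z : rcpow x z != 0.
Proof.
have : rcpow x z * cexp (- (z * (ln x)%:C)) != 0.
  by rewrite -cexpD subrr cexp0 oner_neq0.
by rewrite mulf_eq0 negb_or => /andP[].
Qed.

Lemma rcpowV (x : R) z : 0 < x -> rcpow x^-1 z = (rcpow x z)^-1.
Proof.
move=> x0; apply: (mulfI (rcpow_neq0 x z)).
by rewrite -rcpowM ?invr_gt0 // !divff ?rcpow_neq0 ?rcpow1 // gt_eqF.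
Qed.

Lemma rcpowX (x : R) z n : 0 < x -> rcpow (x ^+ n) z = rcpow x z ^+ n.
Proof.
move=> x0; elim: n => [|n IH]; first by rewrite !expr0 rcpow1.
by rewrite !exprS rcpowM ?exprn_gt0 // IH.
Qed.

(** The modulus of [rcpow x z] is [expR (Re z * ln x)], and [ln x] is nonzero for [1 < x]. *)
Lemma normsq_rcpow_eq1 (x : R) z : 1 < x ->
  normsq (rcpow x z) = 1 -> complex.Re z = 0.
Proof.
move=> x1; rewrite /rcpow normsq_cexp => /eqP.
rewrite pexpr_eq1 ?expR_ge0 // => /eqP.
rewrite -[X in _ = X]expR0 => /expR_inj.
have -> : complex.Re (z * (ln x)%:C) = complex.Re z * ln x.
  by case: z => a b /=; ring.
by move/eqP; rewrite mulf_eq0 [ln x == 0]gt_eqF ?ln_gt0 // orbF => /eqP.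
Qed.

Lemma Re_half z : complex.Re (z / 2%:R) = complex.Re z / 2.
Proof.
have -> : z / 2%:R = (2^-1 : R)%:C * z.
  by rewrite mulrC fmorphV rmorph_nat.
by rewrite Re_realM mulrC.
Qed.
End Complex.

(** * Divisors of coprime products and of prime powers *)

Lemma perm_divisors_coprime (m n : nat) : (0 < m)%N -> (0 < n)%N ->
  coprime m n ->
  perm_eq (divisors (m * n)) [seq (d * e)%N | d <- divisors m, e <- divisors n].
Proof.
move=> m0 n0 co; apply: uniq_perm; first exact: divisors_uniq.
  apply: allpairs_uniq; rewrite ?divisors_uniq //.
  move=> [d e] [d' e'] /allpairsP[[x y] /= [xm yn [-> ->]]].
  move=> /allpairsP[[x' y'] /= [x'm y'n [-> ->]]] /= eqxy.
  rewrite -!dvdn_divisors // in xm yn x'm y'n.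
  (* By coprimality, the gcds with [m] and [n] recover both factors of [u * v], so the pairing is
     injective. *)
  have gl u v : (u %| m)%N -> (v %| n)%N -> gcdn m (u * v) = u.
    move=> um vn; rewrite Gauss_gcdl ?(coprime_dvdr vn) //.
    exact/gcdn_idPr.
  have gr u v : (u %| m)%N -> (v %| n)%N -> gcdn n (u * v) = v.
    move=> um vn; rewrite Gauss_gcdr ?(coprime_dvdr um) 1?coprime_sym //.
    exact/gcdn_idPr.
  congr (_, _).
    by rewrite -(gl x y xm yn) eqxy gl.
  by rewrite -(gr x y xm yn) eqxy gr.
move=> d; rewrite -dvdn_divisors ?muln_gt0 ?m0 //.
apply/idP/allpairsP => [dmn|[[x y] /= [xm yn ->]]]; last first.
  by rewrite dvdn_mul // dvdn_divisors.
exists (gcdn d m, gcdn d n) => /=.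
rewrite -!dvdn_divisors // !dvdn_gcdr; split=> //.
apply/eqP; rewrite eqn_dvd; apply/andP; split; last first.
  rewrite Gauss_dvd ?dvdn_gcdl //.
  exact: coprime_dvdl (dvdn_gcdr _ _) (coprime_dvdr (dvdn_gcdr _ _) co).
by rewrite muln_gcdl !muln_gcdr !dvdn_gcd dmn (dvdn_mulr d) // (dvdn_mulr n) //
  (dvdn_mull m).
Qed.

Lemma perm_divisors_pfactor (p f : nat) : prime p ->
  perm_eq (divisors (p ^ f)) [seq (p ^ k)%N | k <- iota 0 f.+1].
Proof.
move=> pp; have p1 := prime_gt1 pp.
apply: uniq_perm; first exact: divisors_uniq.
  by rewrite map_inj_uniq ?iota_uniq //; exact: expnI.
move=> d; rewrite -dvdn_divisors ?expn_gt0 ?prime_gt0 //.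
apply/(dvdn_pfactor _ _ pp)/mapP => [[k kf ->]|[k kf ->]]; exists k => //.
  by rewrite mem_iota ltnS.
by rewrite mem_iota ltnS in kf.
Qed.

Lemma sum_divisors_pfactor (V : nmodType) (p f : nat) (F : nat -> V) :
  prime p -> \sum_(d <- divisors (p ^ f)) F d = \sum_(k < f.+1) F (p ^ k)%N.
Proof.
move=> pp; rewrite (perm_big _ (perm_divisors_pfactor f pp)) big_map.
by rewrite -[f.+1]subn0 -/(index_iota 0 f.+1) big_mkord subn0.
Qed.

Lemma sigma1_pfactor (R : nzRingType) (p k : nat) : prime p ->
  (p%:R - 1) * (sigma1 (p ^ k))%:R = p%:R ^+ k.+1 - 1 :> R.
Proof.
move=> pp; rewrite subrX1 /sigma1 sum_divisors_pfactor // natr_sum.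
by congr (_ * _); apply: eq_bigr => i _; rewrite natrX.
Qed.

(** * Multiplicativity of [cfun] and its values at prime powers *)

Section Cfun.
Variables (R : realType) (a b : nat -> nat).
Hypotheses (a_mult : multiplicative_arith a) (b_mult : multiplicative_arith b).
Implicit Types (s : R[i]) (m n p f : nat).

Lemma cfun1 s : cfun a b 1 s = 1.
Proof.
rewrite /cfun big_seq1 divn1 a_mult.1 b_mult.1 expr1n divr1 rcpow1.
by rewrite !mulr1.
Qed.

Lemma cfunM m n s : (0 < m)%N -> (0 < n)%N -> coprime m n ->
  cfun a b (m * n) s = cfun a b m s * cfun a b n s.
Proof.
move=> m0 n0 co; rewrite /cfun (perm_big _ (perm_divisors_coprime m0 n0 co)).
rewrite big_allpairs_dep mulr_suml big_seq [RHS]big_seq; apply: eq_bigr => d.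
rewrite -dvdn_divisors // => dm; rewrite mulr_sumr.
rewrite big_seq [RHS]big_seq; apply: eq_bigr => e.
rewrite -dvdn_divisors // => en.
have d0 := dvdn_gt0 m0 dm; have e0 := dvdn_gt0 n0 en.
have -> : (m * n %/ (d * e) = m %/ d * (n %/ e))%N.
  by rewrite -{1}(divnK dm) -{1}(divnK en) mulnACA mulnK // muln_gt0 d0.
have md : (m %/ d %| m)%N by rewrite -{2}(divnK dm) dvdn_mulr.
have ne : (n %/ e %| n)%N by rewrite -{2}(divnK en) dvdn_mulr.
have aM := a_mult.2 _ _ d0 e0 (coprime_dvdl dm (coprime_dvdr en co)).
have bM := b_mult.2 _ _ (dvdn_gt0 m0 md) (dvdn_gt0 n0 ne)
  (coprime_dvdl md (coprime_dvdr ne co)).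
rewrite {}aM {}bM.
have -> : (m * n)%:R / (d * e)%:R ^+ 2 =
  m%:R / d%:R ^+ 2 * (n%:R / e%:R ^+ 2) :> R.
  by rewrite !natrM exprMn invfM mulrACA.
rewrite rcpowM ?divr_gt0 ?exprn_gt0 ?ltr0n // !natrM.
by ring.
Qed.

(** Here [w ^- 2] is [p^(-s)], so up to the nonvanishing [w ^+ f] this is a polynomial in
    [p^(-s)]. *)
Lemma cfun_pfactor p f s : prime p ->
  let w : R[i] := rcpow p%:R (s / 2%:R) in
  cfun a b (p ^ f) s =
  w ^+ f * \sum_(k < f.+1) (a (p ^ k))%:R * (b (p ^ (f - k)))%:R * w ^- 2 ^+ k.
Proof.
move=> pp w; rewrite /cfun sum_divisors_pfactor // mulr_sumr.
have p0 : 0 < p%:R :> R by rewrite ltr0n prime_gt0.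
apply: eq_bigr => k _; rewrite -expnB ?prime_gt0 // -1?ltnS //.
rewrite !natrX rcpowM ?invr_gt0 ?exprn_gt0 // rcpowV ?exprn_gt0 //.
rewrite !rcpowX ?exprn_gt0 // -/w exprVn -!exprM [(2 * k)%N]mulnC.
by ring.
Qed.

Lemma cfun_odd_pfactor p f s : prime p ->
  (forall k, a (p ^ k)%N = sigma1 (p ^ k)) ->
  (forall k, b (p ^ k)%N = sigma1 (p ^ k)) ->
  cfun a b (p ^ f) s = 0 -> complex.Re s = 0.
Proof.
move=> pp aE bE; rewrite cfun_pfactor //=.
set w := rcpow _ _; have w0 : w != 0 by exact: rcpow_neq0.
set z := w ^- 2; move/eqP; rewrite mulf_eq0 expf_eq0 (negPf w0) andbF /=.
move/eqP => S0.
have nz : normsq z = 1.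
  apply/eqP/negPn/negP => nz1.
  have p0 : 0 < p%:R :> R by rewrite ltr0n prime_gt0.
  have := geom_conv_neq0 f p0 nz1; rewrite rmorph_nat => /eqP; apply.
  have p1 : (p%:R - 1 : R[i]) ^+ 2 != 0.
    by rewrite expf_eq0 /= subr_eq0 -[1]/(1%:R) eqr_nat gtn_eqF // prime_gt1.
  (* The factor [(p - 1)^2] serves twice: it enters the exchange identity, and it then supplies one
     [p - 1] to each [sigma1]. No division by [(z - 1)^2] occurs. *)
  apply: (mulfI p1); rewrite -geom_conv_swap mulr0.
  apply/eqP; rewrite mulf_eq0; apply/orP; right; apply/eqP.
  transitivity ((p%:R - 1) ^+ 2 * (0 : R[i])); last by rewrite mulr0.
  rewrite -[in RHS]S0 mulr_sumr; apply: eq_bigr => k _.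
  by rewrite -!sigma1_pfactor // aE bE; ring.
have nw : normsq w = 1.
  have : normsq (w ^+ 2) = 1.
    by rewrite -[LHS]mulr1 -nz -normsqM divff ?normsq1 // expf_neq0.
  by rewrite normsqX => /eqP; rewrite pexpr_eq1 ?normsq_ge0 // => /eqP.
have := normsq_rcpow_eq1 _ nw; rewrite ltr1n prime_gt1 // => /(_ isT).
by rewrite Re_half => /eqP; rewrite mulf_eq0 invr_eq0 pnatr_eq0 orbF => /eqP.
Qed.

Lemma cfun_two_pfactor f s :
  (forall k, a (2 ^ k)%N = (2 ^ k)%N) ->
  (forall k, (1 <= k)%N -> b (2 ^ k)%N = 0%N) ->
  cfun a b (2 ^ f) s != 0.
Proof.
move=> aE bE; rewrite cfun_pfactor //= mulf_neq0 ?expf_neq0 ?rcpow_neq0 //.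
(* Only [k = f] survives, where [b] is evaluated at [2 ^ 0 = 1]. *)
rewrite big_ord_recr /= big1 ?add0r => [|k _]; last first.
  by rewrite bE ?subn_gt0 // mulr0 mul0r.
rewrite subnn expn0 b_mult.1 aE mulr1 mulf_neq0 //.
  by rewrite pnatr_eq0 expn_eq0.
by rewrite expf_neq0 // invr_eq0 expf_neq0 // rcpow_neq0.
Qed.
End Cfun.

Theorem theorem4p2 (R : realType) (a b : nat -> nat)
  (a_mult : multiplicative_arith a)
  (a_odd : forall p f : nat, prime p -> odd p -> a (p ^ f)%N = sigma1 (p ^ f)%N)
  (a_two : forall f : nat, a (2 ^ f)%N = (2 ^ f)%N)
  (b_mult : multiplicative_arith b)
  (b_odd : forall p f : nat, prime p -> odd p -> b (p ^ f)%N = sigma1 (p ^ f)%N)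
  (b_two : forall f : nat, (1 <= f)%N -> b (2 ^ f)%N = 0%N)
  (j : nat) (j_gt0 : (0 < j)%N) (s : R[i]) :
  cfun a b j s = 0%R -> complex.Re s = 0%R.
Proof.
elim/ltn_ind: j j_gt0 => j IH j_gt0.
have [j1|j_gt1] := leqP j 1.
  have -> : j = 1%N by apply/eqP; rewrite eqn_leq j1.
  by rewrite cfun1 // => /eqP; rewrite oner_eq0.
(* Split off the full power of the least prime factor; a zero for [j] is then a zero for one of the
   two coprime factors. *)
have pp := pdiv_prime j_gt1; set p := pdiv j in pp.
have [m co jE] := pfactor_coprime pp j_gt0.
have f0 : (0 < logn p j)%N by rewrite logn_gt0 mem_primes pp j_gt0 pdiv_dvd.
move: (logn p j) f0 jE => f f0 jE.
have m0 : (0 < m)%N by move: j_gt0; rewrite jE muln_gt0 => /andP[].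
have pf0 : (0 < p ^ f)%N by rewrite expn_gt0 prime_gt0.
rewrite jE cfunM // 1?coprime_sym ?coprimeXl // => /eqP.
rewrite mulf_eq0 => /orP[]/eqP; first apply: IH => //.
  (* The cofactor [m] is smaller than [j] because [f] is positive. *)
  by rewrite jE -[ltnLHS]muln1 ltn_pmul2l // -(expn0 p) ltn_exp2l ?prime_gt1.
have [p2|p_odd] := even_prime pp.
  by rewrite p2 => /eqP; rewrite (negPf (cfun_two_pfactor b_mult f s a_two b_two)).
by apply: cfun_odd_pfactor => // k; [exact: a_odd | exact: b_odd].
Qed.
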